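(* Fix $j\in\{1,\dots,N\}$. Let $g\in C^b$ and let $u(z,t,\lambda)$ be the solution of $\partial_tu=\sum_{k=1}^N\lambda_k\partial_{z_k}^2u$ on $\mathbb{R}^N\times(0,T)$, $u(\cdot,0)=g$, regarded as a function of $\lambda\in[0,\infty)^N$ as well. Define $$G_j(z_{-j},z_j,t,\lambda)=\int_{\mathbb{R}^{N-1}}\Phi^{\{1,\dots,N-1\}}(x_{-j},t,1)\,g\big(z-\sqrt{\lambda}\cdot(x_1,\dots,x_{j-1},0,x_{j+1},\dots,x_N)\big)\,dx_{-j}.$$ Suppose that for every fixed $z_{-j},t,\lambda$ the function $G_j(z_{-j},\cdot,t,\lambda)$ is piecewise $C^2$ in the sense that there are a function $\widetilde G_j\in C^{2,1,mix}$ (of the variable $z_j$) and given numbers $a_{i,j},b_{i,j},c_{i,j}$ such that $$G_j(z_j)=\widetilde G_j(z_j)+\sum_{i=0}^N c_{i,j}\max(z_j-a_{i,j},0)+\sum_{i=0}^N b_{i,j}H(z_j-a_{i,j}),$$ where $H$ is the Heaviside function. Then: 1. $\frac{\partial}{\partial\lambda_j}u(z,t,\lambda)$ exists for all $z$ and all $\lambda$ with $\lambda_j>0$; 2. for a given $z_j$, $$\left.\frac{\partial}{\partial\lambda_j}u(z,t,\lambda)\right|_{\lambda_j=0}=t\left.\frac{\partial^2G_j}{\partial z_j^2}(z_{-j},z_j,t,\lambda)\right|_{\lambda_j=0},$$ if the derivative on the right-hand side exists.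
   Context: $C^b$ is the set of bounded continuous functions on $\mathbb{R}^N$. $C^{j,k,mix}=\{g\in C^b:\ \partial_{i_1}^j\cdots\partial_{i_k}^jg\in C^b\ \forall\,1\le i_1<\dots<i_k\le N\}$; for a function of the single real variable $z_j$, $C^{2,1,mix}$ means that the function is bounded and continuous with bounded continuous second derivative. Notation: $x_{-j}=(x_1,\dots,x_{j-1},x_{j+1},\dots,x_N)$ and $dx_{-j}=dx_1\cdots dx_{j-1}dx_{j+1}\cdots dx_N$ (similarly $z_{-j}$); $\sqrt\lambda=(\sqrt{\lambda_1},\dots,\sqrt{\lambda_N})$; $x\cdot y=(x_1y_1,\dots,x_Ny_N)$ is the element-wise product. $\Phi^{\{1,\dots,N-1\}}(x_{-j},t,1)=\prod_{k\ne j}\frac{\exp(-x_k^2/(4t))}{\sqrt{4\pi t}}$ is the $(N-1)$-dimensional heat kernel with all diffusion coefficients equal to $1$. The constants $a_{i,j},b_{i,j},c_{i,j}$ and the function $\widetilde G_j$ may depend on the fixed $z_{-j},t,\lambda$. Note that $G_j$ does not depend on $\lambda_j$. The solution $u$ is given by the Green's function representation $u(z,t,\lambda)=\int_{\mathbb{R}^N}\prod_{k=1}^N\frac{\exp(-y_k^2/(4\lambda_kt))}{\sqrt{4\pi\lambda_kt}}\,g(z-y)\,dy$, where factors with $\lambda_k=0$ are read as Dirac deltas $\delta(y_k)$. The derivative with respect to $\lambda_j$ at $\lambda_j=0$ is one-sided (from $\lambda_j>0$). *)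

(* Defs.v *)
From HB Require Import structures.
From mathcomp Require Import all_boot all_order all_algebra.
From mathcomp Require Import all_classical all_reals all_analysis.

Set Implicit Arguments.
Unset Strict Implicit.
Unset Printing Implicit Defensive.

Import Order.TTheory GRing.Theory Num.Theory.
Import numFieldNormedType.Exports.

Local Open Scope classical_set_scope.
Local Open Scope ring_scope.

Section product_measure.
Context {R : realType}.

Definition cons_pair n (p : measurableTypeR R * n.-tuple (measurableTypeR R)) :
    n.+1.-tuple (measurableTypeR R) :=
  [tuple of p.1 :: p.2].

Lemma measurable_cons_pair n : measurable_fun [set: _] (@cons_pair n).
Proof. by apply: measurable_cons. Qed.

Section prod_cons.
Local Open Scope ereal_scope.
Context n (mu : {sigma_finite_measure set (measurableTypeR R) -> \bar R})
  (nu : {measure set (n.-tuple (measurableTypeR R)) -> \bar R}).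

Definition prod_cons : set (n.+1.-tuple (measurableTypeR R)) -> \bar R :=
  pushforward (mu \x^ nu) (@cons_pair n).

Let prod_cons0 : prod_cons set0 = 0.
Proof. by rewrite /prod_cons /pushforward preimage_set0 measure0. Qed.

Let prod_cons_ge0 A : 0 <= prod_cons A.
Proof. exact: (measure_ge0 (mu \x^ nu)). Qed.

Let prod_cons_sigma_additive : semi_sigma_additive prod_cons.
Proof.
exact: (@measure_semi_sigma_additive _ _ _
  (measure_function_pushforward__canonical__measure_function_Measure
    (mu \x^ nu) (@measurable_cons_pair n))).
Qed.

HB.instance Definition _ := isMeasure.Build _ _ _ prod_cons
  prod_cons0 prod_cons_ge0 prod_cons_sigma_additive.

End prod_cons.

(* mu_0 (x) ... (x) mu_(n-1), on n-tuples with the product sigma-algebra. *)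
Fixpoint prod_measure n :
    ('I_n -> {sigma_finite_measure set (measurableTypeR R) -> \bar R}) ->
    {measure set (n.-tuple (measurableTypeR R)) -> \bar R} :=
  match n with
  | 0 => fun=> \d_([tuple] : 0.-tuple (measurableTypeR R))
  | m.+1 => fun mu =>
      prod_cons (mu ord0) (prod_measure (fun k => mu (lift ord0 k)))
  end.

Lemma prod_measureE n
    (mu : 'I_n -> {sigma_finite_measure set (measurableTypeR R) -> \bar R})
    (A : 'I_n -> set (measurableTypeR R)) :
  (forall i, measurable (A i)) ->
  prod_measure mu [set x | forall i, A i (tnth x i)] =
    (\prod_(i < n) mu i (A i))%E.
Proof.
elim: n mu A => [|n IH] mu A mA.
  rewrite big_ord0 /= diracE mem_set//. by move=> [].
rewrite big_ord_recl /= -IH; last by move=> i; exact: mA.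
rewrite /prod_cons /pushforward -product_measure2E //=.
  congr (_ _); apply/seteqP; split => -[x v] /=.
    move=> h; split; first by have := h ord0.
    by move=> i; have := h (lift ord0 i); rewrite tnthS.
  move=> [h1 h2] i; case: (unliftP ord0 i) => [k ->|->//].
  by rewrite tnthS; exact: h2.
rewrite (_ : [set x | _] =
    \bigcap_(i in setT) ((fun x => tnth x i) @^-1` A (lift ord0 i))).
  apply: fin_bigcap_measurable => // i _.
  by rewrite -[X in measurable X]setTI; exact: measurable_tnth.
apply/seteqP; split => x /= h i; last exact: h.
by move=> _; exact: h.
Qed.

End product_measure.

Section heat.
Context {R : realType}.
Implicit Types (t l x : R).

Definition row_of_tuple n (y : n.-tuple R) : 'rV[R]_n := \row_k tnth y k.

(* The row with entry [x] in position [j] and the entries of [v], in order,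
   elsewhere; [col' j] recovers [v]. *)
Definition insert N (j : 'I_N) x (v : 'rV[R]_N.-1) : 'rV[R]_N :=
  \row_k (if unlift j k is Some i then v 0 i else x).

Definition set_entry N (j : 'I_N) x (v : 'rV[R]_N) : 'rV[R]_N :=
  insert j x (col' j v).

Definition Cb (V : normedModType R) (g : V -> R) : Prop :=
  continuous g /\ bounded_fun g.

(* C^{2,1,mix} for functions of one variable: since [derive1] is total, existence
   of the second derivative is required separately. *)
Definition C21mix (f : R -> R) : Prop :=
  [/\ Cb f, forall x, derivable f x 1, forall x, derivable (f^`())%classic x 1
    & Cb (f^`(2))%classic].

Definition twice_derivable_at (f : R -> R) x : Prop :=
  (\forall y \near x, derivable f y 1) /\ derivable (f^`())%classic x 1.

Definition heaviside x : R := (0 <= x)%R%:R.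

Definition heat_kernel l t x : R :=
  expR (- x ^+ 2 / (4 * l * t)) / Num.sqrt (4 * pi * l * t).

(* A coordinate with zero diffusion coefficient carries the Dirac mass at 0 in
   place of the density [heat_kernel]. *)
Definition coord_measure l :
    {sigma_finite_measure set (measurableTypeR R) -> \bar R} :=
  match l == 0 with
  | true => \d_(0 : measurableTypeR R)
  | false => lebesgue_measure
  end.

Definition heat_solution N (g : 'rV[R]_N -> R) (z : 'rV[R]_N) t
    (lam : 'rV[R]_N) : R :=
  \int[prod_measure (fun k => coord_measure (lam 0 k))]_y
    ((\prod_(k < N | lam 0 k != 0) heat_kernel (lam 0 k) t (tnth y k)) *
     g (z - row_of_tuple y)).

(* [z'] stands for z_{-j} and [zj] for z_j; the integral is over R^(N-1). *)
Definition Gfun N (g : 'rV[R]_N -> R) (j : 'I_N) (z' : 'rV[R]_N.-1) (zj : R) t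
    (lam : 'rV[R]_N) : R :=
  \int[prod_measure (fun=> lebesgue_measure)]_x
    ((\prod_(k < N.-1) heat_kernel 1 t (tnth x k)) *
     g (insert j zj z' -
        \row_k (Num.sqrt (lam 0 k) * insert j 0 (row_of_tuple x) 0 k))).

End heat.

(* Main.v *)
Require Import Defs.
From HB Require Import structures.
From mathcomp Require Import all_boot all_order all_algebra.
From mathcomp Require Import all_classical all_reals all_analysis.
From mathcomp Require Import measurable_realfun.
From mathcomp Require Import zify ring lra.
Set Implicit Arguments.
Unset Strict Implicit.
Unset Printing Implicit Defensive.
Import Order.TTheory GRing.Theory Num.Theory.
Import numFieldNormedType.Exports.
Local Open Scope classical_set_scope.
Local Open Scope ring_scope.

(** Write phi(y) for G_j(z_{-j}, y, t, lambda), a function of the j-th variable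
that does not depend on lambda_j.  The whole proof rests on the identity
(lemma [heat_solution_coord])

  u(z, t, lambda) = E[phi(z_j - sqrt(lambda_j) X)],

valid for every lambda_j >= 0, where X is a centred Gaussian variable of
variance 2t.  It is obtained by substituting y_k = sqrt(lambda_k) x_k in every
coordinate, which turns both the Green's function integral of u and the
integral that defines G_j into integrals against a product of copies of the law
of X (the Dirac masses being absorbed by the case lambda_k = 0), and then by
integrating out the coordinates other than j with Fubini's theorem.  Since g is
bounded and continuous, phi is bounded and measurable.

For lambda_j = l > 0 the expectation is the integral of K(l, t, y) phi(z_j - y)
where K is the heat kernel.  Near a given l0, the derivative of K with respect
to l is bounded by a constant multiple of K(4 l0, t, y) (lemma
[heat_kernel_dl_le]), so that one can differentiate under the integral sign;
this is the first claim.

For the second claim, the same differentiation applied to phi = 1 gives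
E[X^2] = 2t, and E[X] = 0 by parity.  When phi is twice differentiable at z_j,
the quotient

  (phi(z_j - sqrt(l) X) - phi(z_j) + phi'(z_j) sqrt(l) X) / l

converges to phi''(z_j) X^2 / 2 as l decreases to 0 by Taylor's formula, and it
is bounded by C X^2 uniformly in l because phi is bounded.  By dominated
convergence its expectation, which is the difference quotient of u, tends to
phi''(z_j) E[X^2] / 2 = t phi''(z_j) (lemma [heat_prob_small_time]). *)

(** * Product measures on tuples *)

Section product_measure_change.
Context {R : realType}.
Local Open Scope ereal_scope.
Notation mR := (measurableTypeR R).

Lemma prod_measure_sigma_finite n
    (mu : 'I_n -> {sigma_finite_measure set mR -> \bar R}) :
  sigma_finite setT (prod_measure mu).
Proof.
have /choice[F hF] : forall i, exists F : (set mR)^nat,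
    [/\ setT = \bigcup_k F k, nondecreasing_seq F &
        forall k, measurable (F k) /\ mu i (F k) < +oo].
  by move=> i; exact/sigma_finiteP/sigma_finiteT.
exists (fun k => [set x : n.-tuple mR | forall i, F i k (tnth x i)]).
  apply/seteqP; split=> // x _.
  have /choice[m hm] : forall i, exists k, F i k (tnth x i).
    move=> i; have [FT _ _] := hF i.
    have : setT (tnth x i) by [].
    by rewrite FT => -[k _ ?]; exists k.
  exists (\max_i m i)%N => //= i; have [_ ndF _] := hF i.
  have /subsetPset := ndF _ _ (leq_bigmax i : (m i <= \max_i m i)%N).
  by apply; exact: hm.
move=> k; split.
  rewrite (_ : [set x | _] =
      \bigcap_(i in setT) ((fun x : n.-tuple mR => tnth x i) @^-1` F i k)).
    apply: fin_bigcap_measurable => // i _.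
    rewrite -[X in measurable X]setTI; apply: measurable_tnth => //.
    by have [_ _ /(_ k)[]] := hF i.
  by apply/seteqP; split=> x /= h i; [move=> _|]; exact: h.
have mF i : measurable (F i k) by have [_ _ /(_ k)[]] := hF i.
have -> := prod_measureE mu mF.
rewrite -ge0_fin_numE; last by apply: prode_ge0 => i _.
by apply: prode_fin_num => i _; rewrite ge0_fin_numE//; have [_ _ /(_ k)[]] := hF i.
Qed.

Section sfprod_measure.
Context n (mu : 'I_n -> {sigma_finite_measure set mR -> \bar R}).

(** The product measure, packaged as a sigma-finite measure so that the theorems
of Tonelli and Fubini apply to it. *)
Definition sfprod_measure : set (n.-tuple mR) -> \bar R := prod_measure mu.

HB.instance Definition _ := Measure.on sfprod_measure.

HB.instance Definition _ := Measure_isSigmaFinite.Build _ _ _ sfprod_measure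
  (prod_measure_sigma_finite mu).

End sfprod_measure.

Lemma prod_measure_tonelli n
    (mu : 'I_n.+1 -> {sigma_finite_measure set mR -> \bar R})
    (F : n.+1.-tuple mR -> \bar R) :
  measurable_fun setT F -> (forall x, 0 <= F x) ->
  \int[prod_measure mu]_x F x =
  \int[mu ord0]_a \int[prod_measure (fun k => mu (lift ord0 k))]_v
     F [tuple of a :: v].
Proof.
move=> mF F0.
pose nu := sfprod_measure (fun k => mu (lift ord0 k)).
have mc := @measurable_cons_pair R n.
transitivity (\int[pushforward (mu ord0 \x^ nu) (@cons_pair R n)]_x F x) => //.
rewrite ge0_integral_pushforward//= preimage_setT.
transitivity (\int[mu ord0 \x nu]_x (F \o @cons_pair R n) x).
  apply: eq_measure_integral => A mA _; apply/esym/product_measure_unique => //.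
  by move=> B C mB mC; rewrite /= product_measure2E.
rewrite fubini_tonelli1//; first exact: measurableT_comp.
by move=> x /=; exact: F0.
Qed.

Lemma measurable_mktuple d (T : measurableType d) n (f : T -> 'I_n -> R) :
  (forall k, measurable_fun setT (fun x => f x k)) ->
  measurable_fun setT (fun x => [tuple f x k | k < n] : n.-tuple mR).
Proof.
move=> mf; apply/measurable_fun_tnthP => k.
by apply: eq_measurable_fun (mf k) => x _ /=; rewrite tnth_mktuple.
Qed.

Lemma measurable_tuple_map n (h : 'I_n -> R -> R) :
  (forall k, measurable_fun setT (h k)) ->
  measurable_fun setT
    (fun x : n.-tuple mR => [tuple h k (tnth x k) | k < n] : n.-tuple mR).
Proof.
move=> mh; apply: (measurable_mktuple (T := (n.-tuple mR : measurableType _))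
  (f := fun x k => h k (tnth x k))) => k.
by apply: (measurableT_comp (mh k)); exact: measurable_tnth.
Qed.

Lemma measurable_prod_tnth n (w : 'I_n -> R -> R) :
  (forall k, measurable_fun setT (w k)) ->
  measurable_fun setT (fun x : n.-tuple mR => \prod_k w k (tnth x k))%R.
Proof.
move=> mw; apply: measurable_prod => k _.
by apply: (measurableT_comp (mw k)); exact: measurable_tnth.
Qed.

(** If, in each coordinate, the measure with density [w k] with respect to [mu k]
is the image of [nu k] under [h k], then the product with density the product of
the [w k] is the image of the product of the [nu k].  The hypothesis on each
coordinate is expressed by the integrals of nonnegative functions, which avoids
forming the measures with densities. *)
Lemma ge0_prod_measure_change n
    (mu nu : 'I_n -> {sigma_finite_measure set mR -> \bar R})
    (w : 'I_n -> R -> R) (h : 'I_n -> R -> R) :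
  (forall k, measurable_fun setT (w k)) -> (forall k x, (0 <= w k x)%R) ->
  (forall k, measurable_fun setT (h k)) ->
  (forall k (f : mR -> \bar R), measurable_fun setT f -> (forall x, 0 <= f x) ->
     \int[mu k]_x ((w k x)%:E * f x) = \int[nu k]_x f (h k x)) ->
  forall F : n.-tuple mR -> \bar R,
    measurable_fun setT F -> (forall x, 0 <= F x) ->
  \int[prod_measure mu]_x ((\prod_k w k (tnth x k))%:E * F x) =
  \int[prod_measure nu]_x F [tuple h k (tnth x k) | k < n].
Proof.
elim: n mu nu w h => [|n IH] mu nu w h mw w0 mh hwh F mF F0.
  rewrite !integral_dirac//=; last 2 first.
    by apply: measurableT_comp => //; exact: measurable_tuple_map.
    apply: emeasurable_funM => //; apply/measurable_EFinP.
    exact: measurable_prod_tnth.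
  rewrite !diracT !mul1e big_ord0 mul1e; congr F; apply: eq_from_tnth.
  by case.
have mwF : measurable_fun setT
    (fun x : n.+1.-tuple mR => (\prod_k w k (tnth x k))%:E * F x).
  apply: emeasurable_funM => //; apply/measurable_EFinP.
  exact: measurable_prod_tnth.
rewrite prod_measure_tonelli//; last first.
  by move=> x; rewrite mule_ge0// lee_fin prodr_ge0.
rewrite [RHS]prod_measure_tonelli//; last first.
  by apply: measurableT_comp => //; exact: measurable_tuple_map.
have mFc a : measurable_fun setT (fun v : n.-tuple mR => F [tuple of a :: v]).
  by apply: measurableT_comp => //; exact: measurable_cons.
pose nu' k := nu (lift ord0 k).
pose G (a : mR) := \int[prod_measure nu']_v
   F [tuple of a :: [tuple h (lift ord0 k) (tnth v k) | k < n]].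
have mG : measurable_fun setT G.
  apply: (@measurable_fun_fubini_tonelli_F _ _ _ _ _ (sfprod_measure nu')
    (fun p : mR * n.-tuple mR => F [tuple of p.1 ::
       [tuple h (lift ord0 k) (tnth p.2 k) | k < n]])) => //.
  apply: measurableT_comp => //; apply: measurable_cons => //.
  have /measurableT_comp := measurable_tuple_map (fun k => mh (lift ord0 k)).
  exact.
have G0 a : 0 <= G a by apply: integral_ge0.
transitivity (\int[mu ord0]_a ((w ord0 a)%:E * G a)).
  apply: eq_integral => a _.
  rewrite /G -(IH (fun k => mu (lift ord0 k)) nu' (fun k => w (lift ord0 k))
     (fun k => h (lift ord0 k)) _ _ _ _ (fun v => F [tuple of a :: v]))//; last first.
    by move=> k f mf f0; exact: hwh.
  have mwv : measurable_fun setT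
      (fun v : n.-tuple mR =>
         (\prod_k w (lift ord0 k) (tnth v k))%:E * F [tuple of a :: v]).
    apply: emeasurable_funM => //; apply/measurable_EFinP.
    by apply: (measurable_prod_tnth (w := fun k => w (lift ord0 k))).
  rewrite -ge0_integralZl ?lee_fin//; last first.
    by move=> x _; rewrite mule_ge0// lee_fin prodr_ge0.
  apply: eq_integral => v _; rewrite big_ord_recl muleA -EFinM tnth0.
  by congr (_%:E * _); congr (_ * _)%R; apply: eq_bigr => k _; rewrite tnthS.
rewrite hwh//; apply: eq_integral => a _; apply: eq_integral => v _.
congr F; apply: eq_from_tnth => i; rewrite tnth_mktuple.
case: (unliftP ord0 i) => [k ->|->]; last by rewrite !tnth0.
by rewrite !tnthS tnth_mktuple.
Qed.

(** A change of variables known for nonnegative functions holds for every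
measurable function, integrable or not, since it respects positive and negative
parts. *)
Lemma Rintegral_transfer d d' (X : measurableType d) (Y : measurableType d')
    (mu : {measure set X -> \bar R}) (nu : {measure set Y -> \bar R})
    (w : X -> R) (h : Y -> X) :
  (forall x, (0 <= w x)%R) ->
  (forall f : X -> \bar R, measurable_fun setT f -> (forall x, 0 <= f x) ->
     \int[mu]_x ((w x)%:E * f x) = \int[nu]_y f (h y)) ->
  forall F : X -> R, measurable_fun setT F ->
  (\int[mu]_x (w x * F x) = \int[nu]_y F (h y))%R.
Proof.
move=> w0 wh F mF; congr fine.
have mEF : measurable_fun setT (EFin \o F) by exact/measurable_EFinP.
rewrite [LHS]integralE [RHS]integralE; congr (_ - _).
- rewrite (funepos_comp (EFin \o F) h) -wh//; last exact: measurable_funepos.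
  apply: eq_integral => x _.
  rewrite -(congr1 (fun f => f x) (ge0_funeposM (EFin \o F) (w0 x))) !funeposE //=.
- rewrite (funeneg_comp (EFin \o F) h) -wh//; last exact: measurable_funeneg.
  apply: eq_integral => x _.
  rewrite -(congr1 (fun f => f x) (ge0_funenegM (EFin \o F) (w0 x))) !funenegE //=.
Qed.

Lemma prod_measure_change n
    (mu nu : 'I_n -> {sigma_finite_measure set mR -> \bar R})
    (w : 'I_n -> R -> R) (h : 'I_n -> R -> R) :
  (forall k, measurable_fun setT (w k)) -> (forall k x, (0 <= w k x)%R) ->
  (forall k, measurable_fun setT (h k)) ->
  (forall k (f : mR -> \bar R), measurable_fun setT f -> (forall x, 0 <= f x) ->
     \int[mu k]_x ((w k x)%:E * f x) = \int[nu k]_x f (h k x)) ->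
  forall F : n.-tuple mR -> R, measurable_fun setT F ->
  (\int[prod_measure mu]_x ((\prod_k w k (tnth x k)) * F x) =
   \int[prod_measure nu]_x F [tuple h k (tnth x k) | k < n])%R.
Proof.
move=> mw w0 mh hwh F mF.
apply: (@Rintegral_transfer _ _ _ _ (prod_measure mu) (prod_measure nu)
  (fun x : n.-tuple mR => \prod_k w k (tnth x k))%R
  (fun x : n.-tuple mR => [tuple h k (tnth x k) | k < n])) => //.
  by move=> x; exact: prodr_ge0.
exact: ge0_prod_measure_change.
Qed.

End product_measure_change.

(** * Splitting off one coordinate *)

Section prod_measure_insert.
Context {R : realType}.
Local Open Scope ereal_scope.
Notation mR := (measurableTypeR R).

Section pprod_measure.
Context n (P : 'I_n -> probability mR R).

(** The product of probability measures, packaged as a probability measure. *)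
Definition pprod_measure : set (n.-tuple mR) -> \bar R :=
  prod_measure (fun k => P k).

HB.instance Definition _ := Measure.on pprod_measure.

Lemma pprod_measure_setT : pprod_measure setT = 1.
Proof.
rewrite /pprod_measure (_ : setT = [set x | forall i, [set: mR] (tnth x i)]).
  have -> := prod_measureE (fun k => P k) (A := fun=> setT) (fun=> measurableT).
  by rewrite big1// => k _; exact: probability_setT.
by apply/seteqP; split.
Qed.

HB.instance Definition _ := Measure_isProbability.Build _ _ _ pprod_measure
  pprod_measure_setT.

End pprod_measure.

(** The tuple with entry [a] in position [j] and the entries of [v], in order,
elsewhere. *)
Definition tuple_insert n (j : 'I_n.+1) (a : R) (v : n.-tuple R) : n.+1.-tuple R :=
  [tuple if unlift j k is Some i then tnth v i else a | k < n.+1].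

Lemma tuple_insert0 n a (v : n.-tuple R) : tuple_insert ord0 a v = [tuple of a :: v].
Proof.
apply: eq_from_tnth => i; rewrite tnth_mktuple.
by case: unliftP => [k ->|->]; rewrite ?tnthS ?tnth0.
Qed.

Lemma tuple_insertS n (j : 'I_n.+1) a b (v : n.-tuple R) :
  tuple_insert (lift ord0 j) a [tuple of b :: v] =
  [tuple of b :: tuple_insert j a v].
Proof.
apply: eq_from_tnth => i; rewrite tnth_mktuple.
case: (unliftP ord0 i) => [k ->|->].
  rewrite tnthS tnth_mktuple; case: (unliftP j k) => [l ->|->].
    rewrite (_ : lift ord0 (lift j l) = lift (lift ord0 j) (lift ord0 l)) ?liftK ?tnthS//.
    by apply/val_inj; rewrite /= /bump /=; lia.
  by rewrite unlift_none.
rewrite tnth0 (_ : ord0 = lift (lift ord0 j) ord0) ?liftK ?tnth0//.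
exact/val_inj.
Qed.

Lemma measurable_tuple_insert d (T : measurableType d) n (j : 'I_n.+1)
    (f : T -> mR) (g : T -> n.-tuple mR) :
  measurable_fun setT f -> measurable_fun setT g ->
  measurable_fun setT (fun x => tuple_insert j (f x) (g x) : n.+1.-tuple mR).
Proof.
move=> mf mg; apply: (@measurable_mktuple R _ T _
  (fun x k => if unlift j k is Some i then tnth (g x) i else f x)) => k.
case: (unlift j k) => [i|//].
exact: (measurableT_comp (@measurable_tnth _ mR n i) mg).
Qed.

(** By induction on the position: the coordinate [j] is moved past the first one
by Tonelli's theorem. *)
Lemma ge0_prod_measure_insert n (mu : {sigma_finite_measure set mR -> \bar R})
    (j : 'I_n.+1) (F : n.+1.-tuple mR -> \bar R) :
  measurable_fun setT F -> (forall x, 0 <= F x) ->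
  \int[prod_measure (fun=> mu)]_x F x =
  \int[mu]_a \int[prod_measure (fun=> mu)]_v F (tuple_insert j a v).
Proof.
elim: n j F => [|n IH] j F mF F0.
  rewrite (prod_measure_tonelli (fun=> mu) mF F0) (ord1 j).
  apply: eq_integral => a _; apply: eq_integral => v _.
  by rewrite tuple_insert0.
case: (unliftP ord0 j) => [i ->|->]; last first.
  rewrite (prod_measure_tonelli (fun=> mu) mF F0).
  apply: eq_integral => a _; apply: eq_integral => v _.
  by rewrite tuple_insert0.
rewrite (prod_measure_tonelli (fun=> mu) mF F0).
pose nu := @sfprod_measure R n (fun=> mu).
transitivity (\int[mu]_b \int[mu]_a \int[nu]_v F [tuple of b :: tuple_insert i a v]).
  apply: eq_integral => b _; rewrite (IH i (fun v => F [tuple of b :: v]))//.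
  by apply: measurableT_comp => //; exact: measurable_cons.
have mG : measurable_fun setT (fun p : (mR * mR) * n.-tuple mR =>
    F [tuple of p.1.1 :: tuple_insert i p.1.2 p.2]).
  apply: measurableT_comp => //; apply: measurable_cons.
    by apply: measurableT_comp.
  by apply: measurable_tuple_insert => //; apply: measurableT_comp.
rewrite (fubini_tonelli (fun p : mR * mR =>
    \int[nu]_v F [tuple of p.1 :: tuple_insert i p.2 v])); last 2 first.
  exact: (@measurable_fun_fubini_tonelli_F _ _ _ _ _ nu _ mG).
  by move=> p; exact: integral_ge0.
apply: eq_integral => a _.
have mFa : measurable_fun setT
    (fun v : n.+1.-tuple mR => F (tuple_insert (lift ord0 i) a v)).
  by apply: measurableT_comp => //; exact: measurable_tuple_insert.
rewrite (prod_measure_tonelli (fun=> mu) mFa)//.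
apply: eq_integral => b _; apply: eq_integral => v _.
by rewrite tuple_insertS.
Qed.

Lemma bounded_integrable d (T : measurableType d) (P : probability T R)
    (f : T -> R) (M : R) : measurable_fun setT f -> (forall x, `|f x| <= M)%R ->
  P.-integrable setT (EFin \o f).
Proof.
move=> mf fM; apply: measurable_bounded_integrable => //.
  by rewrite (le_lt_trans (probability_le1 _ _))// ltry.
exists M; split; first exact: num_real.
by move=> x Mx y _; apply: (le_trans (fM y)); exact: ltW.
Qed.

Lemma bounded_Rintegral_le d (T : measurableType d) (P : probability T R)
    (f : T -> R) (M : R) : measurable_fun setT f -> (forall x, `|f x| <= M)%R ->
  (`|\int[P]_x f x| <= M)%R.
Proof.
move=> mf fM.
have intf := bounded_integrable P mf fM.
apply: (le_trans (le_normr_Rintegral measurableT intf)).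
have -> : M = (\int[P]_x (cst M x))%R.
  by rewrite Rintegral_cst// [X in fine X]probability_setT mulr1.
apply: le_Rintegral => //.
- exact: integrable_norm.
- apply: (@bounded_integrable _ _ _ _ `|M|%R) => //.
Qed.

Lemma measurable_Rintegral_section d d' (X : measurableType d) (Y : measurableType d')
    (mu : probability X R) (nu : probability Y R) (f : X * Y -> R) (M : R) :
  measurable_fun setT f -> (forall x, `|f x| <= M)%R ->
  measurable_fun setT (fun x => \int[nu]_y f (x, y))%R.
Proof.
move=> mf fM; apply: (measurableT_comp (fine_measurable measurableT)).
apply: (@measurable_fubini_F _ _ _ _ _ mu nu (EFin \o f)).
exact: (bounded_integrable (mu \x nu)%E mf fM).
Qed.

Lemma Rintegral_prod_measure_insert n (P : probability mR R) (j : 'I_n.+1)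
    (F : n.+1.-tuple mR -> R) (M : R) :
  measurable_fun setT F -> (forall x, `|F x| <= M)%R ->
  (\int[prod_measure (fun=> P)]_x F x =
   \int[P]_a \int[prod_measure (fun=> P)]_v F (tuple_insert j a v))%R.
Proof.
move=> mF FM.
pose nu := @pprod_measure n (fun=> P).
pose I (p : mR * n.-tuple mR) := tuple_insert j p.1 p.2.
have mI : measurable_fun setT I by exact: measurable_tuple_insert.
have mFI : measurable_fun setT (F \o I) by exact: measurableT_comp.
transitivity (\int[P \x nu]_p (F \o I) p)%R.
  rewrite -(@Rintegral_transfer _ _ _ _ _ (prod_measure (fun=> P)) (P \x nu)
    (cst 1%R) I)//.
    by apply: eq_Rintegral => x _; rewrite mul1r.
  move=> f mf f0; under eq_integral do rewrite mul1e.
  rewrite (ge0_prod_measure_insert P j)// (fubini_tonelli1 (f \o I))//.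
    exact: measurableT_comp.
  by move=> x; exact: f0.
have intFI : (P \x nu).-integrable setT (EFin \o (F \o I)).
  exact: (bounded_integrable (P \x nu)%E mFI (fun p => FM (I p))).
rewrite /Rintegral -integral12_prod_meas1//; congr fine.
apply: eq_integral => a _; rewrite fineK//.
apply: integrable_fin_num => //.
apply: (bounded_integrable nu (M := M)) => //.
by apply: measurableT_comp => //; exact: measurable_tuple_insert.
Qed.

End prod_measure_insert.

(** * Measurability of continuous functions of row vectors *)

Section measurable_row.
Context {R : realType}.

Lemma cvg_row n (u : nat -> 'rV[R]_n) (l : 'rV[R]_n) :
  (forall k, u m 0 k @[m --> \oo] --> l 0 k) -> u m @[m --> \oo] --> l.
Proof.
move=> ul; apply/cvg_ballP => e e0.
have : \forall m \near \oo, forall k : 'I_n, ball (l 0 k) e (u m 0 k).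
  by apply: filter_forall => k; have /cvg_ballP/(_ e e0) := ul k.
apply: filterS => m um; split=> // i k; rewrite (ord1 i); exact: um.
Qed.

(** [g \o h] is the pointwise limit of the functions obtained by rounding the
entries of [h x] down to multiples of 1/(m+1); these are measurable because they
depend on countably many values only. *)
Lemma continuous_measurable_row n (g : 'rV[R]_n -> R) d (T : measurableType d)
    (h : T -> 'rV[R]_n) :
  continuous g -> (forall k, measurable_fun setT (fun x => h x 0 k)) ->
  measurable_fun setT (g \o h).
Proof.
move=> cg mh.
pose q m x : 'rV[int]_n := \row_k Num.floor (m.+1%:R * h x 0 k).
pose r m (v : 'rV[int]_n) : 'rV[R]_n := \row_k ((v 0 k)%:~R / m.+1%:R).
apply: (measurable_fun_cvg (h := fun m x => g (r m (q m x)))).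
- move=> m _ A mA; rewrite setTI.
  rewrite (_ : _ @^-1` A = \bigcup_(v : 'rV[int]_n)
      [set x | g (r m v) \in A /\ q m x = v]); last first.
    apply/seteqP; split=> [x /= Ax|x [v _ /= [Av ->]]]; last by move: Av; rewrite inE.
    by exists (q m x) => //=; rewrite inE.
  apply: countable_bigcupT_measurable => // v.
  have [gA|gA] := boolP (g (r m v) \in A); last first.
    rewrite (_ : [set x | _] = set0)//; apply/seteqP; split=> [x []|x []] //.
  rewrite (_ : [set x | _] = \bigcap_(k in [set: 'I_n])
     ((fun x => m.+1%:R * h x 0 k) @^-1` `[(v 0 k)%:~R, (v 0 k + 1)%:~R[)).
    apply: fin_bigcap_measurable => // k _; rewrite -[X in measurable X]setTI.
    have := measurable_funM (measurable_cst (m.+1%:R : R)) (mh k).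
    exact.
  apply/seteqP; split=> [x [_ qxv] k _|x /= hx].
    by rewrite /= in_itv /= -floor_eq -qxv mxE.
  split=> //; apply/rowP => k; rewrite mxE; apply/eqP; rewrite floor_eq.
  by have := hx k I; rewrite /= in_itv.
- move=> x _; apply: (cvg_comp (fun m => r m (q m x)) g); last exact: cg.
  apply: cvg_row => k.
  apply: (@squeeze_cvgr _ _ _ _ (fun m => h x 0 k - m.+1%:R^-1) (cst (h x 0 k))).
  + near=> m; rewrite !mxE; have m0 : (0 : R) < m.+1%:R by [].
    have /andP[h1 h2] := floor_itv (m.+1%:R * h x 0 k).
    rewrite ler_pdivrMr// (mulrC (h x 0 k)) h1 andbT ler_pdivlMr// mulrBl.
    by rewrite mulVf ?gt_eqF// (mulrC (h x 0 k)) lerBlDr ltW// -intrD1.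
  + rewrite -[X in _ --> X]subr0; apply: cvgB; first exact: cvg_cst.
    exact: cvg_harmonic.
  + exact: cvg_cst.
Unshelve. all: by end_near. Qed.

End measurable_row.

(** * The Gaussian law of a coordinate *)

Section gaussian.
Context {R : realType}.
Notation mR := (measurableTypeR R).
Notation leb := (@lebesgue_measure R).
Implicit Types (l t x y : R).

Lemma heat_kernelE l t : 0 < l -> 0 < t ->
  heat_kernel l t = normal_pdf 0 (Num.sqrt (2 * l * t)).
Proof.
move=> l0 t0; apply/funext => x.
have lt0 : 0 < 2 * l * t by rewrite !mulr_gt0.
rewrite normal_pdfE ?gt_eqF ?sqrtr_gt0//.
rewrite /heat_kernel [LHS]mulrC /normal_peak /normal_fun sqr_sqrtr ?ltW// subr0.
congr (_ * _); first by congr (Num.sqrt _)^-1; ring.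
by congr (expR (_ / _)); ring.
Qed.

Lemma heat_kernel_ge0 l t x : 0 <= heat_kernel l t x.
Proof. by rewrite divr_ge0// expR_ge0. Qed.

Lemma measurable_heat_kernel l t : measurable_fun setT (heat_kernel l t).
Proof.
apply: measurable_funM => //; apply: measurableT_comp => //.
by apply: measurable_funM => //; apply: measurableT_comp => //; exact: exprn_measurable.
Qed.

(** The normal density is a Radon-Nikodym derivative of the normal law, hence
agrees almost everywhere with the one provided by the general theorem. *)
Lemma ge0_integral_normal_prob (m s : R) (f : mR -> \bar R) :
  measurable_fun setT f -> (forall x, 0 <= f x)%E ->
  (\int[normal_prob m s]_x f x = \int[leb]_x ((normal_pdf m s x)%:E * f x))%E.
Proof.
move=> mf f0.
have dom := normal_prob_dominates m s.
rewrite -(Radon_Nikodym_SigmaFinite.change_of_variables dom)//.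
have mpdf : measurable_fun setT (EFin \o normal_pdf m s).
  by apply/measurable_EFinP; exact: measurable_normal_pdf.
apply: ae_eq_integral => //.
- apply: emeasurable_funM => //.
  exact: measurable_int (Radon_Nikodym_SigmaFinite.f_integrable dom).
- by apply: emeasurable_funM.
- under [X in ae_eq _ _ _ X]eq_fun do rewrite muleC.
  apply: ae_eqe_mul2l.
  apply: integral_ae_eq => //.
    exact: Radon_Nikodym_SigmaFinite.f_integrable.
  by move=> E _ mE; rewrite -Radon_Nikodym_SigmaFinite.f_integral.
Qed.

Lemma ge0_integral_scale (a : R) (f : mR -> \bar R) : 0 < a ->
  measurable_fun setT f -> (forall x, 0 <= f x)%E ->
  (\int[leb]_x f x = a%:E * \int[leb]_x f (a * x)%R)%E.
Proof.
move=> a0 mf f0.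
have ma : measurable_fun [set: mR] ( *%R a : mR -> mR) by exact: mulrl_measurable.
pose pf : {measure set mR -> \bar R} :=
  measure_function_pushforward__canonical__measure_function_Measure leb ma.
pose mu : {measure set mR -> \bar R} := mscale (NngNum (ltW a0)) pf.
have muE A : measurable A -> leb A = mu A.
  apply: lebesgue_measure_unique => _ [[x y] _ <-].
  transitivity (a%:E * leb `](x / a)%R, (y / a)%R])%E.
    rewrite !lebesgue_measure_itv/= !lte_fin ltr_pM2r ?invr_gt0//.
    case: ifPn => _; last by rewrite mule0.
    by rewrite -!EFinD -EFinM; congr EFin; field; exact: lt0r_neq0.
  rewrite /mu /mscale /= /pushforward; congr (_ * leb _)%E.
  by apply/seteqP; split=> z /=; rewrite !in_itv/= ltr_pdivrMr// ler_pdivlMr// mulrC.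
rewrite (eq_measure_integral mu) => [|A mA _]; last exact: muE.
rewrite ge0_integral_mscale//= ge0_integral_pushforward//=.
Qed.

(** The normal law of mean 0 and variance [2 * t]; for [t > 0] its density is
[heat_kernel 1 t]. *)
Definition heat_prob t : probability mR R := normal_prob 0 (Num.sqrt (2 * t)).

Lemma heat_prob_pdf t : 0 < t -> normal_pdf 0 (Num.sqrt (2 * t)) = heat_kernel 1 t.
Proof. by move=> t0; rewrite heat_kernelE// mulr1. Qed.

Lemma ge0_integral_heat_prob l t (f : mR -> \bar R) : 0 < l -> 0 < t ->
  measurable_fun setT f -> (forall x, 0 <= f x)%E ->
  (\int[leb]_x ((heat_kernel l t x)%:E * f x) =
   \int[heat_prob t]_x f (Num.sqrt l * x)%R)%E.
Proof.
move=> l0 t0 mf f0; have sl0 : 0 < Num.sqrt l by rewrite sqrtr_gt0.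
have mK : measurable_fun [set: mR] (fun x => ((heat_kernel l t x)%:E * f x)%E).
  by apply: emeasurable_funM => //; apply/measurable_EFinP; exact: measurable_heat_kernel.
rewrite (ge0_integral_scale sl0)//; last first.
  by move=> x; rewrite mule_ge0// lee_fin heat_kernel_ge0.
have msl : measurable_fun [set: mR] ( *%R (Num.sqrt l) : mR -> mR).
  exact: mulrl_measurable.
have mfs : measurable_fun [set: mR] (fun x => f (Num.sqrt l * x)%R).
  exact: (measurableT_comp mf msl).
rewrite [RHS]ge0_integral_normal_prob//.
have mKs := measurableT_comp mK msl; rewrite -ge0_integralZl ?lee_fin ?ltW//; last first.
  by move=> x _; rewrite mule_ge0// lee_fin heat_kernel_ge0.
apply: eq_integral => x _; rewrite muleA; congr (_ * _)%E; rewrite -EFinM; congr EFin.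
rewrite heat_prob_pdf// /heat_kernel.
rewrite exprMn sqr_sqrtr ?(ltW l0)//.
rewrite (_ : 4 * pi * l * t = (4 * pi * 1 * t) * l); last by ring.
have p0 := pi_gt0 R.
rewrite (sqrtrM l); last by rewrite !mulr_ge0 ?ltW.
rewrite mulrCA; congr (_ * _).
  by congr expR; field; rewrite !gt_eqF.
by rewrite invfM mulrCA divff ?mulr1// gt_eqF.
Qed.

(** The density of a coordinate with diffusion coefficient [l] with respect to
[coord_measure l]; it is 1 against the Dirac mass. *)
Definition coord_density l t x : R := if l != 0 then heat_kernel l t x else 1.

Lemma coord_density_ge0 l t x : 0 <= coord_density l t x.
Proof. by rewrite /coord_density; case: ifP => // _; exact: heat_kernel_ge0. Qed.

Lemma measurable_coord_density l t : measurable_fun setT (coord_density l t).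
Proof.
by rewrite /coord_density; case: (l != 0) => //; exact: measurable_heat_kernel.
Qed.

(** For [l = 0] both sides are the value of [f] at 0, so that vanishing diffusion
coefficients need no separate treatment from here on. *)
Lemma ge0_integral_coord_measure l t (f : mR -> \bar R) : 0 <= l -> 0 < t ->
  measurable_fun setT f -> (forall x, 0 <= f x)%E ->
  (\int[coord_measure l]_x ((coord_density l t x)%:E * f x) =
   \int[heat_prob t]_x f (Num.sqrt l * x)%R)%E.
Proof.
move=> l0 t0 mf f0; rewrite /coord_measure /coord_density.
case: eqP => [->|/eqP ln0] /=; last first.
  by apply: ge0_integral_heat_prob => //; rewrite lt_def ln0.
rewrite sqrtr0; under [RHS]eq_integral do rewrite mul0r.
rewrite integral_dirac//; last by apply: emeasurable_funM.
rewrite diracE in_setT !mul1e integral_cst//.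
by rewrite [X in (_ * X)%E]probability_setT mule1.
Qed.

End gaussian.

(** * The solution as a one-dimensional Gaussian average *)

Section representation.
Context {R : realType}.
Notation mR := (measurableTypeR R).

Lemma Cb_bounded n (g : 'rV[R]_n -> R) : Cb g -> exists M, forall x, `|g x| <= M.
Proof.
move=> [_ [M [_ gM]]]; exists (M + 1) => x.
by apply: gM => //; rewrite ltrDl.
Qed.

(** The solution is the expectation of g(z - sqrt(lambda) . X), where the X_k are
independent with law [heat_prob t]. *)
Lemma heat_solutionE N (g : 'rV[R]_N -> R) (z : 'rV[R]_N) (t : R) (lam : 'rV[R]_N) :
  continuous g -> 0 < t -> (forall k, 0 <= lam 0 k) ->
  heat_solution g z t lam =
  \int[prod_measure (fun=> heat_prob t)]_x
     g (z - \row_k (Num.sqrt (lam 0 k) * tnth x k)).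
Proof.
move=> cg t0 lam0.
pose F (y : N.-tuple mR) := g (z - row_of_tuple y).
have mF : measurable_fun setT F.
  apply: (continuous_measurable_row
    (h := fun y : N.-tuple mR => z - row_of_tuple y) cg) => k.
  under eq_fun do rewrite !mxE.
  by apply: measurable_funB => //; exact: measurable_tnth.
transitivity (\int[prod_measure (fun k => coord_measure (lam 0 k))]_y
    ((\prod_k coord_density (lam 0 k) t (tnth y k)) * F y)).
  apply: eq_Rintegral => y _; rewrite big_mkcond; congr (_ * _).
rewrite (@prod_measure_change R N (fun k => coord_measure (lam 0 k))
   (fun=> heat_prob t) (fun k => coord_density (lam 0 k) t)
   (fun k x => Num.sqrt (lam 0 k) * x) _ _ _ _ F)//.
- apply: eq_Rintegral => x _; rewrite /F; congr (g (z - _)).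
  by apply/rowP => k; rewrite !mxE tnth_mktuple.
- by move=> k; exact: measurable_coord_density.
- by move=> k x; exact: coord_density_ge0.
- by move=> k; exact: mulrl_measurable.
- by move=> k f mf f0; exact: ge0_integral_coord_measure.
Qed.

Section split_coordinate.
Context n (g : 'rV[R]_n.+1 -> R) (j : 'I_n.+1).
Hypothesis hg : Cb g.

Let integrand (z' : 'rV[R]_n) (lam : 'rV[R]_n.+1) (p : mR * n.-tuple mR) :=
  g (insert j p.1 z' -
     \row_k (Num.sqrt (lam 0 k) * insert j 0 (row_of_tuple p.2) 0 k)).

Let measurable_integrand z' lam : measurable_fun setT (integrand z' lam).
Proof.
apply: (continuous_measurable_row (h := fun p : mR * n.-tuple mR => insert j p.1 z' -
     \row_k (Num.sqrt (lam 0 k) * insert j 0 (row_of_tuple p.2) 0 k)) (proj1 hg)) => k.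
under eq_fun do rewrite !mxE; apply: measurable_funB.
  by case: (unlift j k) => [i|]; [exact: measurable_cst|exact: measurable_fst].
apply: measurable_funM; first exact: measurable_cst.
case: (unlift j k) => [i|]; last exact: measurable_cst.
under eq_fun do rewrite mxE.
exact: (measurableT_comp (@measurable_tnth _ mR _ i)
  (@measurable_snd _ _ mR (n.-tuple mR))).
Qed.

(** The same for G_j, an expectation over the coordinates other than j. *)
Lemma GfunE (z' : 'rV[R]_n) zj t (lam : 'rV[R]_n.+1) : 0 < t ->
  Gfun g j z' zj t lam =
  \int[prod_measure (fun=> heat_prob t)]_v
    g (insert j zj z' -
       \row_k (Num.sqrt (lam 0 k) * insert j 0 (row_of_tuple v) 0 k)).
Proof.
move=> t0.
pose F (v : n.-tuple mR) := integrand z' lam (zj, v).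
have mF : measurable_fun setT F.
  by apply: (measurableT_comp (measurable_integrand z' lam)).
rewrite /Gfun /=.
transitivity (\int[prod_measure (fun=> heat_prob t)]_x
    F [tuple id (tnth x k) | k < n]); last first.
  by apply: eq_Rintegral => x _; congr F; apply: eq_from_tnth => k; rewrite tnth_mktuple.
apply: (@prod_measure_change R n (fun=> lebesgue_measure) (fun=> heat_prob t)
   (fun=> heat_kernel 1 t) (fun=> id)) => //.
- by move=> k; exact: measurable_heat_kernel.
- by move=> k x; exact: heat_kernel_ge0.
- move=> _ f mf f0; rewrite ge0_integral_heat_prob// sqrtr1.
  by under eq_integral do rewrite mul1r.
Qed.

Lemma Gfun_bounded : exists M, forall z' zj t lam, 0 < t -> `|Gfun g j z' zj t lam| <= M.
Proof.
have [M gM] := Cb_bounded hg; exists M => z' zj t lam t0; rewrite GfunE//.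
pose nu := @pprod_measure R n (fun=> heat_prob t).
apply: (@bounded_Rintegral_le _ _ _ nu (fun v => integrand z' lam (zj, v))).
  by apply: (measurableT_comp (measurable_integrand z' lam)).
by move=> v; exact: gM.
Qed.

Lemma measurable_Gfun z' t lam : 0 < t ->
  measurable_fun setT (fun zj => Gfun g j z' zj t lam).
Proof.
move=> t0; have [M gM] := Cb_bounded hg.
pose nu := @pprod_measure R n (fun=> heat_prob t).
under eq_fun do rewrite GfunE//.
apply: (@measurable_Rintegral_section R _ _ _ _ (heat_prob t) nu
  (integrand z' lam) M) => //.
by move=> p; exact: gM.
Qed.

(** Conditioning on X_j expresses the solution as a one-dimensional Gaussian
average of G_j, in which lambda_j only appears through the factor sqrt(l). *)
Lemma heat_solution_coord z t (lam : 'rV[R]_n.+1) l :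
  0 < t -> (forall k, 0 <= lam 0 k) -> 0 <= l ->
  heat_solution g z t (set_entry j l lam) =
  \int[heat_prob t]_a Gfun g j (col' j z) (z 0 j - Num.sqrt l * a) t lam.
Proof.
move=> t0 lam0 l0; have [M gM] := Cb_bounded hg.
have setE k : set_entry j l lam 0 k = if unlift j k is Some i then lam 0 k else l.
  by rewrite mxE; case: unliftP => [i ->|//]; rewrite mxE.
have set0 k : 0 <= set_entry j l lam 0 k by rewrite setE; case: unlift.
rewrite heat_solutionE//; last exact: (proj1 hg).
rewrite (@Rintegral_prod_measure_insert R n (heat_prob t) j _ M) => [||x]; last exact: gM.
  apply: eq_Rintegral => a _.
  rewrite (GfunE (col' j z) (z 0 j - Num.sqrt l * a) lam t0).
  apply: eq_Rintegral => v _; congr g; apply/rowP => k.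
  rewrite !mxE tnth_mktuple.
  case: unliftP => [i ->|->]; first by rewrite !mxE.
  by rewrite mulr0 subr0.
apply: (continuous_measurable_row (h := fun x : n.+1.-tuple mR => z -
     \row_k (Num.sqrt (set_entry j l lam 0 k) * tnth x k)) (proj1 hg)) => k.
under eq_fun do rewrite !mxE; apply: measurable_funB => //.
by apply: measurable_funM => //; exact: measurable_tnth.
Qed.

End split_coordinate.

Lemma set_entry_id N (j : 'I_N) (lam : 'rV[R]_N) : set_entry j (lam 0 j) lam = lam.
Proof.
apply/rowP => k; rewrite mxE.
by case: unliftP => [i ->|->//]; rewrite mxE.
Qed.

End representation.

(** * Differentiation of the heat integral in the diffusion coefficient *)

Section heat_kernel_derivative.
Context {R : realType}.
Notation mR := (measurableTypeR R).
Notation leb := (@lebesgue_measure R).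
Implicit Types (l t x y : R).

(** The derivative of [heat_kernel l t y] with respect to [l]. *)
Definition heat_kernel_dl l t y : R :=
  heat_kernel l t y * (y ^+ 2 / (4 * l ^+ 2 * t) - (2 * l)^-1).

Lemma is_derive_heat_kernel l t y : 0 < l -> 0 < t ->
  is_derive l 1 (fun l => heat_kernel l t y) (heat_kernel_dl l t y).
Proof.
(* [pi] is generalized because [field] would unfold it. *)
move=> l0 t0; rewrite /heat_kernel_dl /heat_kernel.
move: (@pi R) (pi_gt0 R) => p p0.
have c0 : 0 < 4 * p * l * t by rewrite !mulr_gt0.
have d0 : 4 * l * t != 0 by rewrite gt_eqF// !mulr_gt0.
have s0 : Num.sqrt (4 * p * l * t) != 0 by rewrite gt_eqF// sqrtr_gt0.
have dlin (a : R) : is_derive l 1 (fun l => a * l * t) (a * t).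
  have -> : (fun l => a * l * t) = (a * t) *: (@id R).
    by apply/funext => x; rewrite fctE /= /GRing.scale /=; ring.
  by apply: is_derive_eq; rewrite /GRing.scale /= mulr1.
have dexp : is_derive l 1 (fun l => expR (- y ^+ 2 / (4 * l * t)))
    (expR (- y ^+ 2 / (4 * l * t)) * (- y ^+ 2 * (- (4 * l * t) ^- 2 * (4 * t)))).
  apply: (@is_derive1_comp _ expR (fun l => - y ^+ 2 / (4 * l * t))).
  have := @is_deriveV _ (fun l => 4 * l * t) l (4 * t) 1 d0 (dlin 4).
  move=> /(@is_deriveZ _ _ _ _ (- y ^+ 2)).
  exact.
have dsqrt : is_derive l 1 (fun l => (Num.sqrt (4 * p * l * t))^-1)
    (- Num.sqrt (4 * p * l * t) ^- 2 *
      ((2 * Num.sqrt (4 * p * l * t))^-1 * (4 * p * t))).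
  apply: is_deriveV => //.
  exact: (@is_derive1_comp _ (@Num.sqrt R) (fun l => 4 * p * l * t) l _ _
    (is_derive1_sqrt c0) (dlin (4 * p))).
have := @is_deriveM _ _ (fun l => expR (- y ^+ 2 / (4 * l * t)))
  (fun l => (Num.sqrt (4 * p * l * t))^-1) l 1 _ _ dexp dsqrt.
move=> /is_derive_eq; apply.
rewrite /GRing.scale /=.
set S := Num.sqrt _ in s0 *; set E := expR _.
have S2 : S ^+ 2 = 4 * p * l * t by rewrite sqr_sqrtr// ltW.
have -> : - S ^- 2 * ((2 * S)^-1 * (4 * p * t)) = - S^-1 * (2 * l)^-1.
  by rewrite S2; field; rewrite s0 !gt_eqF.
by field; rewrite s0 !gt_eqF.
Qed.

(** From e^q >= 1 + q. *)
Lemma expR_mul_le (q : R) : 0 <= q -> expR (- q) * (16 * q + 1) <= 16.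
Proof.
move=> q0; rewrite mulrC expRN ler_pdivrMr ?expR_gt0//.
have := expR_ge1Dx q; lra.
Qed.

Section domination.
Variables (l0 l t y : R).
Hypotheses (l00 : 0 < l0) (t0 : 0 < t) (ll0 : l0 / 2 < l < 2 * l0).

Let q := y ^+ 2 / (16 * l0 * t).

Let q0 : 0 <= q.
Proof. by rewrite divr_ge0 ?sqr_ge0// !mulr_ge0 ?ltW. Qed.

Let l_gt0 : 0 < l.
Proof. by have /andP[h _] := ll0; apply: lt_trans h; rewrite divr_gt0. Qed.

(** The factor e^(-q) is kept to absorb, in [heat_kernel_dl_le], the polynomial
factor of the derivative. *)
Lemma heat_kernel_le :
  heat_kernel l t y <= 4 * expR (- q) * heat_kernel (4 * l0) t y.
Proof.
have /andP[lo hi] := ll0; rewrite /heat_kernel.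
(* [pi] is generalized because [ring] would unfold it. *)
move: (@pi R) (pi_gt0 R) => p p0.
have e1 : expR (- y ^+ 2 / (4 * l * t)) <= expR (- q) * expR (- q).
  rewrite -expRD ler_expR mulNr -opprD lerN2 /q -mulrDr ler_wpM2l ?sqr_ge0//.
  rewrite (_ : _ + _ = (8 * l0 * t)^-1); last by field; rewrite !gt_eqF.
  rewrite lef_pV2 ?posrE ?mulr_gt0// ler_pM2r//; lra.
have e2 : (Num.sqrt (4 * p * l * t))^-1 <= 4 / Num.sqrt (4 * p * (4 * l0) * t).
  rewrite ler_pdivlMr ?sqrtr_gt0 ?mulr_gt0// mulrC ler_pdivrMr ?sqrtr_gt0 ?mulr_gt0//.
  have -> : 4 * Num.sqrt (4 * p * l * t) = Num.sqrt (4 ^+ 2 * (4 * p * l * t)).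
    by rewrite [RHS]sqrtrM ?sqr_ge0// sqrtr_sqr ger0_norm.
  rewrite ler_sqrt; last by rewrite !mulr_ge0 ?sqr_ge0 ?ltW.
  rewrite -subr_ge0.
  rewrite (_ : _ - _ = 16 * p * t * (4 * l - l0)); last by ring.
  by rewrite !mulr_ge0 ?ltW//; lra.
have -> : 4 * expR (- q) * (expR (- y ^+ 2 / (4 * (4 * l0) * t)) /
    Num.sqrt (4 * p * (4 * l0) * t)) =
    (expR (- q) * expR (- q)) * (4 / Num.sqrt (4 * p * (4 * l0) * t)).
  rewrite (_ : - y ^+ 2 / (4 * (4 * l0) * t) = - q); first by ring.
  by rewrite /q; field; rewrite !gt_eqF.
by apply: ler_pM.
Qed.

Lemma heat_kernel_dl_le :
  `|heat_kernel_dl l t y| <= 64 / l0 * heat_kernel (4 * l0) t y.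
Proof.
have /andP[lo hi] := ll0.
rewrite normrM (ger0_norm (heat_kernel_ge0 _ _ _)).
have K0 := heat_kernel_ge0 (4 * l0) t y.
have f1 : `|y ^+ 2 / (4 * l ^+ 2 * t) - (2 * l)^-1| <= (16 * q + 1) / l0.
  rewrite (le_trans (ler_normB _ _))// ger0_norm; last first.
    by rewrite divr_ge0 ?sqr_ge0// !mulr_ge0 ?sqr_ge0// ltW.
  rewrite ger0_norm; last by rewrite invr_ge0 mulr_ge0// ltW.
  rewrite [leRHS]mulrDl div1r lerD//.
    rewrite (_ : 16 * q / l0 = y ^+ 2 / (l0 ^+ 2 * t)); last first.
      by rewrite /q; field; rewrite !gt_eqF.
    rewrite ler_wpM2l ?sqr_ge0// lef_pV2 ?posrE ?mulr_gt0 ?exprn_gt0//.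
    by rewrite ler_pM2r//; nra.
  by rewrite lef_pV2 ?posrE ?mulr_gt0//; lra.
rewrite (le_trans (ler_pM (heat_kernel_ge0 _ _ _) (normr_ge0 _) heat_kernel_le f1))//.
have -> : 4 * expR (- q) * heat_kernel (4 * l0) t y * ((16 * q + 1) / l0) =
    4 / l0 * heat_kernel (4 * l0) t y * (expR (- q) * (16 * q + 1)) by ring.
have -> : 64 / l0 * heat_kernel (4 * l0) t y =
    4 / l0 * heat_kernel (4 * l0) t y * 16 by ring.
by rewrite ler_wpM2l ?expR_mul_le// mulr_ge0// divr_ge0// ltW.
Qed.

End domination.

Lemma integrable_heat_kernel l t : 0 < l -> 0 < t ->
  leb.-integrable setT (EFin \o heat_kernel l t).
Proof. by move=> l0 t0; rewrite heat_kernelE//; exact: integrable_normal_pdf. Qed.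

Lemma integrable_heat_kernelM l t (f : mR -> R) M : 0 < l -> 0 < t ->
  measurable_fun setT f -> (forall x, `|f x| <= M) ->
  leb.-integrable setT (fun y => (heat_kernel l t y * f y)%:E).
Proof.
move=> l0 t0 mf fM.
have := @integrableMl _ _ _ leb _ measurableT _ _ (integrable_heat_kernel l0 t0) mf.
apply; exists M; split; first exact: num_real.
by move=> x Mx y _; apply: (le_trans (fM y)); exact: ltW.
Qed.

Lemma Rintegral_heat_prob l t (f : mR -> R) : 0 < l -> 0 < t ->
  measurable_fun setT f ->
  \int[leb]_y (heat_kernel l t y * f y) = \int[heat_prob t]_x f (Num.sqrt l * x).
Proof.
move=> l0 t0 mf.
apply: (@Rintegral_transfer R _ _ _ _ leb (heat_prob t) (heat_kernel l t)
  (fun x => Num.sqrt l * x)) => //.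
  by move=> x; exact: heat_kernel_ge0.
by move=> h mh h0; exact: ge0_integral_heat_prob.
Qed.

Section under.
Variables (l0 t M : R) (f : mR -> R).
Hypotheses (l00 : 0 < l0) (t0 : 0 < t) (mf : measurable_fun setT f)
  (fM : forall x, `|f x| <= M).

Let partial_heat_kernel l y : 0 < l ->
  partial1of2 (fun l y => heat_kernel l t y * f y) l y = heat_kernel_dl l t y * f y.
Proof.
move=> lp; have dK := is_derive_heat_kernel y lp t0.
rewrite /partial1of2 derive1E.
have -> : (fun l => heat_kernel l t y * f y) = (f y) *: (fun l => heat_kernel l t y).
  by apply/funext => z; rewrite /= mulrC.
by rewrite derive_val /GRing.scale /= mulrC.
Qed.

Let hyps : [/\ `]l0 / 2, 2 * l0[%classic l0,
  forall l, `]l0 / 2, 2 * l0[%classic l ->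
    leb.-integrable setT (EFin \o (fun y => heat_kernel l t y * f y)),
  forall l (y : mR), `]l0 / 2, 2 * l0[%classic l -> setT y ->
    derivable (fun l => heat_kernel l t y * f y) l 1,
  leb.-integrable setT (EFin \o (fun y => 64 / l0 * M * heat_kernel (4 * l0) t y)) &
  forall l (y : mR), `]l0 / 2, 2 * l0[%classic l -> setT y ->
    `|partial1of2 (fun l y => heat_kernel l t y * f y) l y| <=
     64 / l0 * M * heat_kernel (4 * l0) t y].
Proof.
have lpos l : `]l0 / 2, 2 * l0[%classic l -> 0 < l.
  by rewrite /= in_itv/= => /andP[+ _]; apply: lt_trans; rewrite divr_gt0.
have l0_itv : l0 / 2 < l0 < 2 * l0 by have h := l00; apply/andP; split; lra.
split.
- by rewrite /= in_itv/=.
- by move=> l /lpos l1; exact: (integrable_heat_kernelM l1 t0 mf fM).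
- move=> l y /lpos l1 _.
  have -> : (fun l => heat_kernel l t y * f y) = (f y) *: (fun l => heat_kernel l t y).
    by apply/funext => z; rewrite /= mulrC.
  apply: derivableZ; exact: (@ex_derive _ _ _ _ _ _ _ (is_derive_heat_kernel y l1 t0)).
- have l40 : 0 < 4 * l0 by rewrite mulr_gt0.
  exact: (@integrableZl _ _ _ leb _ measurableT (64 / l0 * M) _
    (integrable_heat_kernel l40 t0)).
- move=> l y ll _; rewrite partial_heat_kernel ?lpos// normrM mulrAC.
  by apply: ler_pM => //; apply: heat_kernel_dl_le.
Qed.

Let G_ge0 (y : mR) : 0 <= 64 / l0 * M * heat_kernel (4 * l0) t y.
Proof.
have M0 : 0 <= M := le_trans (normr_ge0 _) (fM 0).
by rewrite mulr_ge0 ?heat_kernel_ge0// mulr_ge0// divr_ge0// ltW.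
Qed.

(** Differentiation under the integral sign on the interval from [l0 / 2] to
[2 * l0], where [64 / l0 * M * heat_kernel (4 * l0) t y] dominates. *)
Lemma derivable_heat_integral :
  derivable (fun l => \int[leb]_y (heat_kernel l t y * f y)) l0 1.
Proof.
have [h1 h2 h3 h4 h5] := hyps.
exact: (derivable_under_integral measurableT h1 h2 h3 G_ge0 h4 h5).
Qed.

Lemma derive_heat_integral :
  (fun l => \int[leb]_y (heat_kernel l t y * f y))^`()%classic l0 =
  \int[leb]_y (heat_kernel_dl l0 t y * f y).
Proof.
have [h1 h2 h3 h4 h5] := hyps.
rewrite (differentiation_under_integral measurableT h1 h2 h3 G_ge0 h4 h5).
by apply: eq_Rintegral => y _; rewrite partial_heat_kernel.
Qed.

End under.

End heat_kernel_derivative.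

(** * Moments of the Gaussian law *)

Section moments.
Context {R : realType}.
Notation mR := (measurableTypeR R).
Notation leb := (@lebesgue_measure R).
Variable t : R.
Hypothesis t0 : 0 < t.

Let m2 : measurable_fun setT (fun y : mR => y ^+ 2 : R) := exprn_measurable 2.

Let integrable_dl : leb.-integrable setT (EFin \o heat_kernel_dl 1 t).
Proof.
have t0' := t0.
apply: (@le_integrable _ _ _ leb _ _ _ (fun y => (64 * heat_kernel 4 t y)%:E)) => //.
- apply/measurable_EFinP; apply: measurable_funM; first exact: measurable_heat_kernel.
  by apply: measurable_funB => //; apply: measurable_funM.
- move=> y _ /=; rewrite lee_fin.
  rewrite (ger0_norm (mulr_ge0 _ (heat_kernel_ge0 _ _ _)))//.
  have := @heat_kernel_dl_le R 1 1 t y ltr01 t0; rewrite divr1 !mulr1; apply.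
  by apply/andP; split; lra.
- have k4 : 0 < (4 : R) by [].
  exact: (@integrableZl _ _ _ leb _ measurableT 64 _ (integrable_heat_kernel k4 t0)).
Qed.

(* The second moment is read off the derivative of the kernel at [l = 1], whose
   integral vanishes because the total mass does not depend on [l]. *)
Let sqr_heat_kernelE (y : mR) : heat_kernel 1 t y * y ^+ 2 =
  4 * t * heat_kernel_dl 1 t y + 2 * t * heat_kernel 1 t y.
Proof. by rewrite /heat_kernel_dl; field; rewrite gt_eqF. Qed.

Let i1 : leb.-integrable setT (EFin \o (fun y => 4 * t * heat_kernel_dl 1 t y)) :=
  @integrableZl _ _ _ leb _ measurableT (4 * t) _ integrable_dl.

Let i2 : leb.-integrable setT (EFin \o (fun y => 2 * t * heat_kernel 1 t y)) :=
  @integrableZl _ _ _ leb _ measurableT (2 * t) _ (integrable_heat_kernel ltr01 t0).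

Lemma Rintegral_heat_kernel l : 0 < l -> \int[leb]_y heat_kernel l t y = 1.
Proof.
move=> l0.
rewrite (_ : heat_kernel l t = fun y => heat_kernel l t y * cst 1 y); last first.
  by apply/funext => y; rewrite mulr1.
rewrite Rintegral_heat_prob// Rintegral_cst//.
by rewrite [X in fine X]probability_setT mulr1.
Qed.

Let Rintegral_dl : \int[leb]_y heat_kernel_dl 1 t y = 0.
Proof.
have cst_le1 (y : mR) : `|cst 1 y : R| <= 1 by rewrite normr1.
have := derive_heat_integral ltr01 t0 (measurable_cst _) cst_le1.
under [in RHS]eq_Rintegral do rewrite mulr1.
move=> <-; rewrite derive1E.
rewrite (@near_eq_derive R R R _ (cst (1 : R))); first by rewrite derive_cst.
near=> l; under eq_Rintegral do rewrite mulr1.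
rewrite Rintegral_heat_kernel//; near: l; exact: lt_nbhsr.
Unshelve. all: by end_near. Qed.

Let integrable_leb_sqr :
  leb.-integrable setT (EFin \o (fun y => heat_kernel 1 t y * y ^+ 2)).
Proof.
rewrite (_ : (fun y => _) =
    fun y => 4 * t * heat_kernel_dl 1 t y + 2 * t * heat_kernel 1 t y).
  exact: (integrableD measurableT i1 i2).
by apply/funext => y; exact: sqr_heat_kernelE.
Qed.

Lemma integrable_heat_prob_sqr :
  (heat_prob t).-integrable setT (fun x => (x ^+ 2)%:E).
Proof.
apply/integrableP; split; first exact/measurable_EFinP.
have := @ge0_integral_heat_prob R 1 t (fun x => `|(x ^+ 2)%:E|)%E ltr01 t0.
rewrite sqrtr1; under [in X in _ = X]eq_integral do rewrite mul1r.
move=> <-//; last by apply: measurableT_comp => //; exact/measurable_EFinP.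
have /integrableP[_] := integrable_leb_sqr.
apply: le_lt_trans; apply: ge0_le_integral => //.
- by move=> x _; rewrite mule_ge0// lee_fin heat_kernel_ge0.
- apply: emeasurable_funM.
    by apply/measurable_EFinP; exact: measurable_heat_kernel.
  by apply: measurableT_comp => //; exact/measurable_EFinP.
- apply: measurableT_comp => //; apply/measurable_EFinP.
  by apply: measurable_funM => //; exact: measurable_heat_kernel.
- move=> x _ /=; rewrite -EFinM lee_fin [leRHS]normrM.
  by rewrite (ger0_norm (heat_kernel_ge0 _ _ _)).
Qed.

Lemma integrable_heat_prob_id : (heat_prob t).-integrable setT (fun x => x%:E).
Proof.
have ic : (heat_prob t).-integrable setT (EFin \o cst 1).
  by apply: (bounded_integrable _ (M := 1)) => // x; rewrite normr1.
have := integrableD measurableT ic integrable_heat_prob_sqr.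
apply: le_integrable => //; first exact/measurable_EFinP.
move=> x _ /=; rewrite lee_fin [leRHS]ger0_norm ?addr_ge0 ?sqr_ge0//.
by rewrite -real_normK ?num_real//; have := sqr_ge0 (`|x| - 2^-1); lra.
Qed.

Lemma Rintegral_heat_prob_sqr : \int[heat_prob t]_x (x ^+ 2) = 2 * t.
Proof.
have := @Rintegral_heat_prob R 1 t (fun x => x ^+ 2) ltr01 t0 m2.
rewrite sqrtr1; under [in RHS]eq_Rintegral do rewrite mul1r.
move=> <-; under eq_Rintegral do rewrite sqr_heat_kernelE.
rewrite RintegralD// !RintegralZl//; last first.
  exact: integrable_heat_kernel.
by rewrite Rintegral_dl Rintegral_heat_kernel// mulr0 add0r mulr1.
Qed.

Lemma Rintegral_heat_prob_id : \int[heat_prob t]_x x = 0.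
Proof.
have := @Rintegral_heat_prob R 1 t id ltr01 t0 (@measurable_id _ _ _).
rewrite sqrtr1; under [in RHS]eq_Rintegral do rewrite mul1r.
move=> <-.
(* [F] is odd and Lebesgue measure is invariant under y |-> -y. *)
pose F (y : mR) : R := heat_kernel 1 t y * y.
have mF : measurable_fun setT F.
  by apply: measurable_funM => //; exact: measurable_heat_kernel.
have iF : leb.-integrable setT (EFin \o F).
  apply/integrableP; split; first exact/measurable_EFinP.
  have /integrableP[_] := integrable_heat_prob_id.
  have := @ge0_integral_heat_prob R 1 t (fun x => `|x%:E|)%E ltr01 t0.
  rewrite sqrtr1; under [in X in _ = X]eq_integral do rewrite mul1r.
  move=> <-//; last by apply: measurableT_comp => //; exact/measurable_EFinP.
  apply: le_lt_trans; apply: ge0_le_integral => //.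
  - apply: measurableT_comp => //; exact/measurable_EFinP.
  - apply: emeasurable_funM.
      by apply/measurable_EFinP; exact: measurable_heat_kernel.
    by apply: measurableT_comp => //; exact/measurable_EFinP.
  - move=> x _ /=; rewrite -EFinM lee_fin [leLHS]normrM.
    by rewrite (ger0_norm (heat_kernel_ge0 _ _ _)).
have mN : measurable_fun [set: mR] (-%R : mR -> mR) by exact: oppr_measurable.
have e : \int[leb]_y F y = \int[leb]_y F (- y).
  rewrite -(@Rintegral_transfer R _ _ _ _ leb leb (cst 1)
    (-%R : mR -> mR)) => [||f mf f0|].
  - by apply: eq_Rintegral => y _; rewrite mul1r.
  - by move=> x; exact: ler01.
  - under eq_integral do rewrite mul1e.
    have := ge0_integral_pushforward mN leb measurableT mf (fun y _ => f0 y).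
    rewrite preimage_setT => <-.
    by apply: eq_measure_integral => A mA _; exact: (esym (lebesgue_measureN mA)).
  - exact: mF.
have : \int[leb]_y F y = - \int[leb]_y F y.
  rewrite {1}e -mulN1r -RintegralZl//.
  by apply: eq_Rintegral => y _; rewrite /F /heat_kernel sqrrN mulrN mulN1r.
by move=> /eqP; rewrite -addr_eq0 -mulr2n mulrn_eq0 => /eqP.
Qed.

End moments.

(** * Small diffusion coefficients *)

Section small_time.
Context {R : realType}.
Notation mR := (measurableTypeR R).

Section taylor.
Variables (f : R -> R) (x0 : R).
Hypothesis hf : twice_derivable_at f x0.
Let f1 : R := (f^`())%classic x0.
Let f2 : R := (f^`(2))%classic x0.

(** Taylor's formula with Peano remainder: the mean value theorem is applied to
[psi], which is the remainder up to the constant [f x0] and whose derivative at x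
is at most [e * `|x|] in absolute value. *)
Lemma taylor_young2 (e : R) : 0 < e -> exists2 d : R, 0 < d & forall h, `|h| < d ->
  `|f (x0 + h) - f x0 - f1 * h - f2 / 2 * h ^+ 2| <= e * h ^+ 2.
Proof.
move=> e0; have [[d1 /= d10 fd] df'] := hf.
have : \forall h \near (0 : R)^', `|h^-1 * ((f^`())%classic (h + x0) - f1) - f2| <= e.
  have /cvg_ex[/= l] := df'.
  under eq_fun do rewrite scaler1.
  move=> hl; have <- : l = f2 by apply/esym/cvg_lim.
  move/cvgrPdist_le : hl => /(_ e e0).
  by apply: filterS => h; rewrite distrC.
case=> d2 /= d20 hd2.
exists (Num.min d1 d2) => [|h]; first by rewrite lt_min d10.
rewrite lt_min => /andP[hd1 hd2'].
pose psi x := f (x0 + x) - f1 * x - f2 / 2 * x ^+ 2.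
pose dpsi x : R := (f^`())%classic (x0 + x) - f1 - f2 * x.
have is_dpsi (x : R) : `|x| < d1 -> is_derive x 1 psi (dpsi x).
  move=> xd.
  have dfx : is_derive (x0 + x) 1 f ((f^`())%classic (x0 + x)).
    apply: DeriveDef; last by rewrite derive1E.
    by apply: fd; rewrite /ball_ /= opprD addrA subrr add0r normrN.
  have dfs : is_derive x 1 (fun x => f (x0 + x)) ((f^`())%classic (x0 + x)).
    have h1 : is_derive x 1 (fun x => x0 + x) 1.
      by have := is_deriveD (is_derive_cst x0 x 1) (is_derive_id x 1); rewrite add0r.
    by have := @is_derive1_comp _ f (fun x => x0 + x) x _ _ dfx h1; rewrite mulr1.
  have := is_deriveB (is_deriveB dfs (is_deriveZ f1 (is_derive_id x 1)))
    (is_deriveZ (f2 / 2) (is_deriveX 2 (is_derive_id x 1))).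
  move=> /is_derive_eq; apply.
  by rewrite /dpsi /GRing.scale /= !mulr1 expr1; field.
have dpsi_le (x : R) : `|x| < d1 -> `|x| < d2 -> `|dpsi x| <= e * `|x|.
  move=> xd1 xd2; have [->|xn0] := eqVneq x 0.
    by rewrite /dpsi addr0 subrr mulr0 subr0 normr0 mulr0.
  have := hd2 x; rewrite /ball_ /= sub0r normrN => /(_ xd2 xn0) h1.
  rewrite (_ : dpsi x = x * (x^-1 * ((f^`())%classic (x + x0) - f1) - f2)).
    by rewrite normrM mulrC ler_wpM2r.
  by rewrite /dpsi (addrC x0); field.
have psi0 : psi 0 = f x0 by rewrite /psi addr0 mulr0 expr0n mulr0 !subr0.
rewrite (_ : _ - _ = psi h - psi 0); last by rewrite psi0 /psi; ring.
have [h0|h0|->] := ltgtP h 0; last by rewrite subrr normr0 expr0n mulr0.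
- have cpsi : {within `[h, 0], continuous psi}.
    apply: derivable_within_continuous => x; rewrite in_itv/= => /andP[h1 h2].
    apply: (@ex_derive _ _ _ _ _ _ _ (is_dpsi x _)).
    by rewrite ler0_norm// (le_lt_trans _ hd1)// ltr0_norm// lerN2.
  have [|c ch] := @MVT _ psi dpsi h 0 h0 _ cpsi.
    move=> x; rewrite in_itv/= => /andP[h1 h2]; apply: is_dpsi.
    by rewrite ltr0_norm// (lt_trans _ hd1)// ltr0_norm// ltrN2.
  rewrite distrC => ->; rewrite sub0r normrM normrN.
  move: ch; rewrite in_itv/= => /andP[h1 h2].
  have ch : `|c| <= `|h| by rewrite !ltr0_norm// lerN2 ltW.
  rewrite -real_normK ?num_real// expr2 mulrA ler_wpM2r//.
  apply: (le_trans (dpsi_le c _ _)); [exact: le_lt_trans hd1|exact: le_lt_trans hd2'|].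
  by rewrite ler_wpM2l// ltW.
- have cpsi : {within `[0, h], continuous psi}.
    apply: derivable_within_continuous => x; rewrite in_itv/= => /andP[h1 h2].
    apply: (@ex_derive _ _ _ _ _ _ _ (is_dpsi x _)).
    by rewrite ger0_norm// (le_lt_trans _ hd1)// gtr0_norm.
  have [|c ch ->] := @MVT _ psi dpsi 0 h h0 _ cpsi.
    move=> x; rewrite in_itv/= => /andP[h1 h2]; apply: is_dpsi.
    by rewrite gtr0_norm// (lt_trans _ hd1)// gtr0_norm.
  rewrite subr0 normrM.
  move: ch; rewrite in_itv/= => /andP[h1 h2].
  have ch : `|c| <= `|h| by rewrite !gtr0_norm// ltW.
  rewrite -real_normK ?num_real// expr2 mulrA ler_wpM2r//.
  apply: (le_trans (dpsi_le c _ _)); [exact: le_lt_trans hd1|exact: le_lt_trans hd2'|].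
  by rewrite ler_wpM2l// ltW.
Qed.

(** The quadratic bound is global: away from 0 the left-hand side grows at most
linearly in h because [f] is bounded. *)
Lemma bounded_taylor1 (M : R) : (forall x, `|f x| <= M) ->
  exists2 C, 0 <= C & forall h, `|f (x0 + h) - f x0 - f1 * h| <= C * h ^+ 2.
Proof.
move=> fM; have [d d0 hd] := taylor_young2 ltr01.
have M0 : 0 <= M := le_trans (normr_ge0 _) (fM 0).
pose A := 1 + `|f2 / 2|; pose B := 2 * M / d ^+ 2 + `|f1| / d.
have A0 : 0 <= A by rewrite addr_ge0.
have B0 : 0 <= B by rewrite addr_ge0 ?divr_ge0 ?mulr_ge0 ?sqr_ge0// ltW.
(* [A] works for |h| < d and [B] for |h| >= d. *)
exists (A + B) => [|h]; first exact: addr_ge0.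
have [hd'|dh] := ltP `|h| d.
  rewrite (@le_trans _ _ (A * h ^+ 2))//; last first.
    by rewrite ler_wpM2r ?sqr_ge0// lerDl.
  have -> : f (x0 + h) - f x0 - f1 * h =
    (f (x0 + h) - f x0 - f1 * h - f2 / 2 * h ^+ 2) + f2 / 2 * h ^+ 2 by ring.
  rewrite (le_trans (ler_normD _ _))// mulrDl lerD//; first exact: hd.
  by rewrite normrM (ger0_norm (sqr_ge0 _)).
rewrite (@le_trans _ _ (B * h ^+ 2))//; last first.
  by rewrite ler_wpM2r ?sqr_ge0// lerDr.
have h0 : 0 < `|h| := lt_le_trans d0 dh.
rewrite (le_trans (ler_normB _ _))// mulrDl lerD//.
  rewrite (le_trans (ler_normB _ _))//.
  rewrite (@le_trans _ _ (2 * M))//; first by rewrite mulr_natl mulr2n lerD.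
  rewrite mulrAC ler_pdivlMr ?exprn_gt0// ler_wpM2l ?mulr_ge0//.
  by rewrite -(real_normK (num_real h)) ler_pXn2r// ?nnegrE ltW.
rewrite normrM -(real_normK (num_real h)) mulrAC expr2 ler_pdivlMr// mulrA.
by rewrite ler_wpM2l ?mulr_ge0.
Qed.

End taylor.

(** Dominated convergence for the Taylor quotients [psi n] along a sequence [u n]
of positive numbers tending to 0; subtracting the first-order term does not
change their integral because the law is centred. *)
Lemma heat_prob_small_time (f : R -> R) (x0 t M : R) : 0 < t ->
  measurable_fun setT f -> (forall x, `|f x| <= M) -> twice_derivable_at f x0 ->
  h^-1 * (\int[heat_prob t]_a f (x0 - Num.sqrt h * a) - f x0) @[h --> 0^'+]
    --> t * (f^`(2))%classic x0.
Proof.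
move=> t0 mf fM df.
have [C C0 hC] := bounded_taylor1 df fM.
set f1 := (f^`())%classic x0 in hC; set f2 := (f^`(2))%classic x0.
apply/cvg_at_rightP => u [u0 ucvg].
pose psi n (a : mR) : R :=
  (f (x0 + - (Num.sqrt (u n) * a)) - f x0 - f1 * - (Num.sqrt (u n) * a)) / u n.
have su n a : (- (Num.sqrt (u n) * a)) ^+ 2 = u n * a ^+ 2.
  by rewrite sqrrN exprMn sqr_sqrtr// ltW.
have msa n : measurable_fun setT (fun a : mR => Num.sqrt (u n) * a : R).
  exact: mulrl_measurable.
have mfs n : measurable_fun setT (fun a : mR => f (x0 + - (Num.sqrt (u n) * a))).
  apply: measurableT_comp => //; apply: measurable_funD => //.
  exact: measurableT_comp.
have mpsi n : measurable_fun setT (psi n).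
  apply: measurable_funM => //; apply: measurable_funB; first exact: measurable_funB.
  by apply: measurable_funM => //; exact: measurableT_comp.
have psi_le n a : `|psi n a| <= C * a ^+ 2.
  rewrite /psi normrM normfV (gtr0_norm (u0 n)) ler_pdivrMr//.
  by rewrite (le_trans (hC _))// su mulrAC mulrA.
have psi_cvg a : psi n a @[n --> \oo] --> f2 / 2 * a ^+ 2.
  apply/cvgrPdist_le => e e0.
  have a1 : 0 < 1 + a ^+ 2 by rewrite ltr_pwDl// sqr_ge0.
  (* The Taylor estimate is only needed at the point sqrt(u n) a; dividing [e]
     by 1 + a^2 rather than a^2 covers a = 0. *)
  have e1 : 0 < e / (1 + a ^+ 2) by rewrite divr_gt0.
  have [d d0 hd] := taylor_young2 df e1.
  have d1 : 0 < d ^+ 2 / (1 + a ^+ 2) by rewrite divr_gt0// exprn_gt0.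
  near=> n.
  have un : u n < d ^+ 2 / (1 + a ^+ 2).
    rewrite -(gtr0_norm (u0 n)); near: n.
    by move/cvgr0_norm_lt : ucvg => /(_ _ d1).
  have sd : `|- (Num.sqrt (u n) * a)| < d.
    rewrite -(@ltr_pXn2r _ 2)// ?nnegrE ?ltW// real_normK ?num_real// su.
    move: un; rewrite ltr_pdivlMr//; apply: le_lt_trans.
    by rewrite ler_wpM2l ?(ltW (u0 n))// lerDr.
  have := hd _ sd; rewrite su => hd'.
  rewrite distrC.
  have -> : psi n a - f2 / 2 * a ^+ 2 =
    (f (x0 + - (Num.sqrt (u n) * a)) - f x0 - f1 * - (Num.sqrt (u n) * a)
     - f2 / 2 * (u n * a ^+ 2)) / u n.
    by rewrite /psi; field; rewrite gt_eqF.
  rewrite normrM normfV (gtr0_norm (u0 n)) ler_pdivrMr//.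
  rewrite (le_trans hd')// mulrCA mulrC ler_wpM2r ?(ltW (u0 n))//.
  by rewrite mulrAC ler_pdivrMr// ler_wpM2l ?ltW// ltrDr.
pose P := heat_prob t.
have isqr := integrable_heat_prob_sqr t0.
have iid := integrable_heat_prob_id t0.
have iC : P.-integrable setT (fun a => (C * a ^+ 2)%:E).
  exact: (@integrableZl _ _ _ P _ measurableT C _ isqr).
have [] := @dominated_convergence _ _ _ P _ measurableT (fun n a => (psi n a)%:E)
  (fun a => (f2 / 2 * a ^+ 2)%:E) (fun a => (C * a ^+ 2)%:E).
- by move=> n; exact/measurable_EFinP.
- by apply/measurable_EFinP; apply: measurable_funM => //; exact: exprn_measurable.
- apply: aeW => a _; apply/fine_cvgP; split; first exact: nearW.
  exact: psi_cvg.
- exact: iC.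
- by apply: aeW => a n _; rewrite /= lee_fin; exact: psi_le.
move=> ilim _ cint.
have ipsi n : P.-integrable setT (EFin \o psi n).
  apply: (le_integrable measurableT _ _ iC); first exact/measurable_EFinP.
  move=> a _ /=; rewrite lee_fin (ger0_norm (mulr_ge0 C0 (sqr_ge0 _))).
  exact: psi_le.
have -> : t * f2 = \int[P]_a (f2 / 2 * a ^+ 2).
  by rewrite RintegralZl// Rintegral_heat_prob_sqr//; field.
have -> : (fun n => (u n)^-1 * (\int[heat_prob t]_a f (x0 - Num.sqrt (u n) * a) - f x0))
    = fun n => \int[P]_a psi n a.
  apply/funext => n.
  have ifs : P.-integrable setT (EFin \o (fun a : mR => f (x0 - Num.sqrt (u n) * a))).
    exact: (bounded_integrable P (mfs n) (fun a => fM _)).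
  have ic : P.-integrable setT (EFin \o (fun a : mR => f x0)).
    exact: (bounded_integrable P (measurable_cst _) (fun a => fM x0)).
  have iB := integrableB measurableT ifs ic.
  have e1 : \int[P]_a psi n a = \int[P]_a
     ((u n)^-1 * (f (x0 - Num.sqrt (u n) * a) - f x0) + (f1 * Num.sqrt (u n) / u n) * a).
    by apply: eq_Rintegral => a _; rewrite /psi; field; rewrite gt_eqF.
  rewrite e1 RintegralD//; last 2 first.
    exact: (@integrableZl _ _ _ P _ measurableT (u n)^-1 _ iB).
    exact: (@integrableZl _ _ _ P _ measurableT _ _ iid).
  rewrite [X in _ = _ + X]RintegralZl// Rintegral_heat_prob_id// mulr0 addr0.
  rewrite RintegralZl// RintegralB// Rintegral_cst//.
  by rewrite [X in _ * fine X]probability_setT mulr1.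
by move: cint; rewrite -(fineK (integrable_fin_num measurableT ilim)) => /fine_cvg.
Unshelve. all: by end_near. Qed.

End small_time.

Theorem proposition21 (R : realType) (N : nat) (j : 'I_N) (T : R) (hT : 0 < T)
    (g : 'rV[R]_N -> R) (hg : Cb g)
    (hG : forall (z' : 'rV[R]_N.-1) (t : R) (lam : 'rV[R]_N),
      0 < t < T -> (forall k, 0 <= lam 0 k) ->
      exists (Gt : R -> R) (a b c : 'I_N.+1 -> R),
        C21mix Gt /\
        forall zj : R,
          Gfun g j z' zj t lam =
            Gt zj + \sum_(i < N.+1) c i * Num.max (zj - a i) 0
                  + \sum_(i < N.+1) b i * heaviside (zj - a i)) :
  (forall (z : 'rV[R]_N) (t : R) (lam : 'rV[R]_N),
     0 < t < T -> (forall k, 0 <= lam 0 k) -> 0 < lam 0 j ->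
     derivable (fun l : R => heat_solution g z t (set_entry j l lam))
               (lam 0 j) 1)
  /\
  (forall (z : 'rV[R]_N) (t : R) (lam : 'rV[R]_N),
     0 < t < T -> (forall k, 0 <= lam 0 k) -> lam 0 j = 0 ->
     twice_derivable_at (fun zj : R => Gfun g j (col' j z) zj t lam) (z 0 j) ->
     h^-1 * (heat_solution g z t (set_entry j h lam) - heat_solution g z t lam)
       @[h --> 0^'+]
     --> t * ((fun zj : R => Gfun g j (col' j z) zj t lam)^`(2))%classic (z 0 j)).
Proof.
case: N j g hg hG => [[]//|n] j g hg _.
split=> z t lam /andP[t0 _] lam0.
- move=> lj0.
  pose f (y : measurableTypeR R) : R := Gfun g j (col' j z) (z 0 j - y) t lam.
  have [M fM] := Gfun_bounded j hg.
  have mf : measurable_fun setT f.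
    apply: (measurableT_comp (measurable_Gfun j hg (col' j z) lam t0)).
    exact: measurable_funB.
  have fM' y : `|f y| <= M by exact: fM.
  apply: near_eq_derivable (derivable_heat_integral lj0 t0 mf fM').
  near=> l.
  have l0 : 0 < l by near: l; exact: lt_nbhsr.
  by rewrite (heat_solution_coord j hg z t0 lam0 (ltW l0)) Rintegral_heat_prob.
- move=> lj0 df.
  have [M fM] := Gfun_bounded j hg.
  have mf := measurable_Gfun j hg (col' j z) lam t0.
  have fM' y : `|Gfun g j (col' j z) y t lam| <= M by exact: fM.
  have u0 : heat_solution g z t lam = Gfun g j (col' j z) (z 0 j) t lam.
    rewrite -[in LHS](set_entry_id j lam) lj0.
    rewrite (heat_solution_coord j hg z t0 lam0 (lexx 0)).
    under eq_Rintegral do rewrite sqrtr0 mul0r subr0.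
    by rewrite Rintegral_cst// [X in fine X]probability_setT mulr1.
  apply: cvg_trans (heat_prob_small_time t0 mf fM' df).
  apply: near_eq_cvg; near=> h.
  have h0 : 0 < h by near: h; exact: nbhs_right_gt.
  by rewrite u0 (heat_solution_coord j hg z t0 lam0 (ltW h0)).
Unshelve. all: by end_near. Qed.
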